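(* Let $m\ge 4$ and let $C$ be an $m\times n$ binary $2$-covering array with $$n>\binom{m-1}{\lfloor m/2\rfloor-1}+m-3\lfloor m/2\rfloor .$$ Then $C$ is equivalent to a matrix $C'$ obtained from the standard maximal binary $2$-covering array of size $m$ by deleting some columns. Moreover, every column $c^i$ of $C$ satisfies $wt(c^i)=\lfloor m/2\rfloor$ if $m$ is even, and $wt(c^i)\in\{\lfloor m/2\rfloor,\lfloor m/2\rfloor+1\}$ if $m$ is odd.
   Context: A binary $t$-covering array of size $m$ and degree $n$ is an $m\times n$ matrix with entries in $\{0,1\}$ such that for any $t$ distinct columns, all $2^t$ binary vectors of length $t$ occur at least once as the restriction of some row to those columns. Two binary matrices are equivalent if one can be transformed into the other by a sequence of row permutations, column permutations, and complementations of individual columns (swapping $0$ and $1$ in that column). The standard maximal binary $2$-covering array of size $m$ is the $m\times\binom{m-1}{\lfloor m/2\rfloor-1}$ binary matrix whose first row is all $1$'s and whose remaining $(m-1)\times\binom{m-1}{\lfloor m/2\rfloor-1}$ submatrix has as its columns all (each exactly once) binary vectors of length $m-1$ having exactly $\lfloor m/2\rfloor-1$ ones. For a binary vector $u$, $wt(u)$ is the number of nonzero entries. *)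

(* Defs.v *)
From HB Require Import structures.
From mathcomp Require Import all_boot all_order all_algebra all_fingroup.

Set Implicit Arguments.
Unset Strict Implicit.
Unset Printing Implicit Defensive.

(* Binary matrices are matrices over bool, with true for 1 and false for 0. *)

Definition wt (m : nat) (u : 'cV[bool]_m) : nat := #|[set i | u i ord0]|.

Definition covering_array (t m n : nat) (C : 'M[bool]_(m, n)) : Prop :=
  forall f : 'I_t -> 'I_n, injective f ->
  forall v : 'rV[bool]_t, exists i : 'I_m, row i (colsub f C) = v.

Definition compl_col (m n : nat) (j : 'I_n) (A : 'M[bool]_(m, n)) :
    'M[bool]_(m, n) :=
  (\matrix_(i, k) (if k == j then ~~ A i k else A i k))%R.

Inductive equivalent (m n : nat) (A : 'M[bool]_(m, n)) :
    'M[bool]_(m, n) -> Prop :=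
| equivalent_refl : equivalent A A
| equivalent_row_perm (s : 'S_m) B :
    equivalent A B -> equivalent A (row_perm s B)
| equivalent_col_perm (s : 'S_n) B :
    equivalent A B -> equivalent A (col_perm s B)
| equivalent_compl_col (j : 'I_n) B :
    equivalent A B -> equivalent A (compl_col j B).

Definition weight_vectors (p k : nat) : {set 'cV[bool]_p} :=
  [set u | wt u == k].

Lemma card_weight_vectors (p k : nat) : #|weight_vectors p k| = 'C(p, k).
Proof.
pose g (u : 'cV[bool]_p) : {set 'I_p} := [set i | u i ord0].
have g_inj : injective g.
  move=> u v /setP guv; apply/matrixP => i j; rewrite (ord1 j).
  by have := guv i; rewrite !inE.
rewrite -(card_imset _ g_inj) -[p in RHS]card_ord -card_draws.
apply: eq_card => A; rewrite !inE; apply/imsetP/idP => [[u + ->]|Ak].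
  by rewrite inE.
have gA : g (\col_i (i \in A))%R = A by apply/setP => i; rewrite inE mxE.
by exists (\col_i (i \in A))%R; rewrite ?gA // inE /wt -/(g _) gA.
Qed.

(* The columns below the top row are listed in the order of the enumeration of
   weight_vectors; any other order gives an equivalent matrix.  The value at
   m = 0, where there is no first row, is a dummy. *)
Definition standard_array (m : nat) :
    'M[bool]_(m, 'C(m.-1, m./2.-1)) :=
  match m with
  | 0 => const_mx true
  | p.+1 =>
      col_mx (const_mx true : 'M_(1, _))
        (\matrix_(i, j)
           (enum_val (cast_ord (esym (card_weight_vectors p (p.+1./2.-1))) j))
             i ord0)%R
  end.

(* A strictly increasing f lists the columns that are kept. *)
Definition delete_columns (m N n : nat) (S : 'M[bool]_(m, N))
    (C : 'M[bool]_(m, n)) : Prop :=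
  exists f : 'I_n -> 'I_N, {homo f : i j / i < j} /\ C = colsub f S.

(* Main.v *)
Require Import Defs.
From HB Require Import structures.
From mathcomp Require Import all_boot all_order all_algebra all_fingroup.
From mathcomp Require Import zify.

Set Implicit Arguments.
Unset Strict Implicit.
Unset Printing Implicit Defensive.

(* Put k = floor(m/2).  After complementing columns, the column supports form
   an intersecting antichain of sets of size at most k.  If one of them has
   size less than k, replacing repeatedly the sets of the lowest level by their
   upper shadow enlarges the family by at least m - k, which contradicts the
   Erdos-Ko-Rado bound.  So all sets have size k.  For m = 2k a further
   complementation puts a chosen row in every support; for m = 2k + 1 a common
   row is given by the Hilton-Milner theorem.

   That theorem is proved for m = 2k + 1 by shifting.  A shift between x and y
   can only create a common point when every set meets {x, y}; the family is
   then controlled by a pair of nonempty cross-intersecting families of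
   (k-1)-subsets of a (2k-1)-set, i.e. by vertex expansion in the middle-levels
   graph, which follows from submodularity and the primitivity of the symmetric
   group on (k-1)-subsets.  Shifted families are handled by induction on the
   size of the ground set. *)

(** * Upper shadows *)

Section SetFamilies.
Variable U : finType.
Implicit Types (A B T : {set U}) (F G P Q : {set {set U}}) (x y z : U).

Definition draws T (k : nat) : {set {set U}} := [set A : {set U} | A \subset T & #|A| == k].

Definition cross P Q := [forall A in P, forall B in Q, A :&: B != set0].

Definition upshadow T F : {set {set U}} :=
  [set B : {set U} | B \subset T & [exists x in B, B :\ x \in F]].

Definition deletion x F := [set A in F | x \notin A].

Definition link x F := [set A :\ x | A in [set B in F | x \in B]].

Lemma crossP P Q :
  reflect (forall A B, A \in P -> B \in Q -> exists2 x, x \in A & x \in B)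
          (cross P Q).
Proof.
apply: (iffP forall_inP) => [h A B AP BQ|h A AP].
  have /forall_inP/(_ B BQ)/set0Pn[x] := h A AP.
  by rewrite inE => /andP[xA xB]; exists x.
apply/forall_inP => B BQ; have [x xA xB] := h A B AP BQ.
by apply/set0Pn; exists x; rewrite inE xA.
Qed.

Lemma card_split x F : #|F| = #|deletion x F| + #|link x F|.
Proof.
rewrite card_in_imset; last first.
  move=> A B; rewrite !inE => /andP[_ xA] /andP[_ xB].
  by move=> /(congr1 (fun C : {set U} => x |: C)); rewrite !setD1K.
rewrite -(cardsID [set A : {set U} | x \in A] F) addnC.
by congr (_ + _); apply: eq_card => A; rewrite !inE // andbC.
Qed.

Lemma linkP x F A : reflect (x \notin A /\ x |: A \in F) (A \in link x F).
Proof.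
apply: (iffP imsetP) => [[B + ->]|[xA xAF]].
  by rewrite inE => /andP[BF xB]; rewrite setD11 setD1K.
by exists (x |: A); rewrite ?setU1K // inE xAF setU11.
Qed.

Lemma drawsP T k A : reflect (A \subset T /\ #|A| = k) (A \in draws T k).
Proof. by rewrite inE; apply: (iffP andP) => -[? /eqP]. Qed.

Lemma cross_sym P Q : cross P Q = cross Q P.
Proof.
by apply/crossP/crossP => h A B AP BQ; have [x] := h B A BQ AP; exists x.
Qed.

Lemma deletion_draws T F r x : F \subset draws T r ->
  deletion x F \subset draws (T :\ x) r.
Proof.
move=> FT; apply/subsetP => A; rewrite inE => /andP[/(subsetP FT)/drawsP[AT cA] xA].
by apply/drawsP; rewrite subsetD1 AT.
Qed.

Lemma link_draws T F r x : F \subset draws T r.+1 ->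
  link x F \subset draws (T :\ x) r.
Proof.
move=> FT; apply/subsetP => A /linkP[xA /(subsetP FT)/drawsP[AT]].
rewrite cardsU1 xA => -[cA]; apply/drawsP; split=> //.
by rewrite subsetD1 xA andbT (subset_trans _ AT) ?subsetUr.
Qed.

Lemma upshadowP T F B :
  reflect (exists A x, [/\ A \in F, x \notin A, B = x |: A & B \subset T])
          (B \in upshadow T F).
Proof.
rewrite inE; apply: (iffP andP) => [[BT /exists_inP[x xB AF]]|].
  by exists (B :\ x), x; rewrite setD11 setD1K.
case=> A [x [AF xA -> xAT]]; split=> //; apply/exists_inP.
by exists x; rewrite ?setU11 // setU1K.
Qed.

Lemma upshadow_draws T F r : F \subset draws T r ->
  upshadow T F \subset draws T r.+1.
Proof.
move=> /subsetP FT; apply/subsetP => _ /upshadowP[A [x [AF xA -> xAT]]].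
by apply/drawsP; rewrite cardsU1 xA; have /drawsP[_ ->] := FT _ AF.
Qed.

Lemma upshadow_ge_nonempty T F r : F \subset draws T r -> F != set0 ->
  #|T| - r <= #|upshadow T F|.
Proof.
move=> FT /set0Pn[A AF]; have /drawsP[AT <-] := subsetP FT _ AF.
rewrite -(cardsDS AT).
have inj : {in T :\: A &, injective (fun x => x |: A)}.
  move=> x y; rewrite !inE => /andP[xA _] /andP[yA _] /setP/(_ x).
  by rewrite !inE eqxx (negPf xA) /= orbF => /esym/eqP.
rewrite -(card_in_imset inj); apply/subset_leq_card/subsetP => B.
case/imsetP=> x; rewrite inE => /andP[xA xT] ->.
by apply/upshadowP; exists A, x; rewrite subUset sub1set xT.
Qed.

(** Double counting: the pairs [(A, x)] with [A] in [F] and [x] in [T] outside [A] inject, by adding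
    [x] to [A], into the pairs of a shadow set and one of its [r.+1] points. *)
Lemma upshadow_double T F r : F \subset draws T r ->
  #|F| * (#|T| - r) <= #|upshadow T F| * r.+1.
Proof.
move=> FT; have UT := upshadow_draws FT.
pose E1 := [set p : {set U} * U | (p.1 \in F) && (p.2 \in T :\: p.1)].
pose E2 := [set p : {set U} * U | (p.1 \in upshadow T F) && (p.2 \in p.1)].
have <- : #|E1| = #|F| * (#|T| - r).
  rewrite -sum1dep_card -(pair_big_dep (mem F) (fun A x => x \in T :\: A) (fun _ _ => 1)) /=.
  rewrite -sum_nat_const; apply: eq_bigr => A /(subsetP FT)/drawsP[AT <-].
  by rewrite sum1_card cardsDS.
have <- : #|E2| = #|upshadow T F| * r.+1.
  rewrite -sum1dep_card -(pair_big_dep (mem (upshadow T F)) (fun A x => x \in A) (fun _ _ => 1)) /=.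
  rewrite -sum_nat_const; apply: eq_bigr => A /(subsetP UT)/drawsP[AT <-].
  by rewrite sum1_card.
pose h (p : {set U} * U) := (p.2 |: p.1, p.2).
have inj : {in E1 &, injective h}.
  move=> [A x] [B y]; rewrite !inE /= => /and3P[_ xA _] /and3P[_ yB _] [+ exy].
  by rewrite -exy in yB * => eAB; rewrite -(setU1K xA) eAB setU1K.
rewrite -(card_in_imset inj); apply/subset_leq_card/subsetP => _ /imsetP[[A x] + ->].
rewrite [in X in X -> _]inE /= !inE => /and3P[AF xA xT].
rewrite eqxx /= andbT subUset sub1set xT.
have /drawsP[-> _] := subsetP FT _ AF.
by apply/exists_inP; exists x; rewrite ?setU11 // setU1K.
Qed.

Lemma upshadow_expand T F r : F \subset draws T r -> r.*2 < #|T| ->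
  #|F| <= #|upshadow T F|.
Proof.
move=> FT rT; rewrite -(leq_pmul2r (ltn0Sn r)).
apply: leq_trans (upshadow_double FT); rewrite leq_mul2l; apply/orP; right; lia.
Qed.

(* Splitting [F] at a point [x] into [F0] (sets avoiding [x]) and [F1] (traces
   on [T :\ x] of the sets containing [x]), the upshadow contains that of [F0],
   and, with [x] added, both [F0] and the upshadow of [F1]. *)
Lemma upshadow_gain T F r : F \subset draws T r -> F != set0 -> r.*2.+1 < #|T| ->
  #|F| + (#|T| - r.+1) <= #|upshadow T F|.
Proof.
have [n] := ubnP #|T|; elim: n T F r => // n IHn T F r leTn FT Fn0 rT.
have [x xT] : exists x, x \in T by apply/set0Pn; rewrite -card_gt0; lia.
pose F0 := deletion x F.
pose F1 := link x F.
have cT : #|T| = #|T :\ x|.+1 by rewrite (cardsD1 x T) xT.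
have cF : #|F| = #|F0| + #|F1| := card_split x F.
have F0T : F0 \subset draws (T :\ x) r := deletion_draws x FT.
pose X := [set x |: B | B in upshadow (T :\ x) F1 :|: F0].
have cX : #|X| = #|upshadow (T :\ x) F1 :|: F0|.
  rewrite card_in_imset // => A B AX BX.
  have nx C : C \in upshadow (T :\ x) F1 :|: F0 -> x \notin C.
    rewrite !inE => /orP[/andP[]|/andP[_] //].
    by rewrite subsetD1 => /andP[].
  by move=> eAB; rewrite -(setU1K (nx _ AX)) eAB setU1K ?nx.
have leX : #|upshadow (T :\ x) F0| + #|X| <= #|upshadow T F|.
  have <- : #|upshadow (T :\ x) F0 :|: X| = #|upshadow (T :\ x) F0| + #|X|.
    apply/eqP; rewrite leq_card_setU disjoints_subset; apply/subsetP => B.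
    rewrite !inE subsetD1 => /andP[/andP[_ xB] _]; apply: contra xB.
    by case/imsetP=> C _ ->; rewrite setU11.
  apply/subset_leq_card; rewrite subUset; apply/andP; split; apply/subsetP => B.
    case/upshadowP=> A [y [+ yA -> yAT]]; rewrite inE => /andP[AF xA].
    apply/upshadowP; exists A, y; split=> //.
    by apply: subset_trans yAT (subsetDl _ _).
  case/imsetP=> C; rewrite inE => /orP[/upshadowP[A [y [+ yA -> yAT]]] ->|].
    case/imsetP=> D; rewrite inE => /andP[DF xD] eA.
    move: yAT; rewrite subUset sub1set in_setD1 => /andP[/andP[yx yT] AT].
    apply/upshadowP; exists D, y; split=> //.
    - by apply: contra yA; rewrite eA !inE yx.
    - by rewrite eA setUCA setD1K.
    - rewrite !subUset !sub1set xT yT /=.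
      exact: subset_trans AT (subsetDl _ _).
  rewrite inE => /andP[CF xC] ->; apply/upshadowP; exists C, x; split=> //.
  by rewrite subUset sub1set xT; have /drawsP[->] := subsetP FT _ CF.
(* If no set contains [x], then [X] alone has [#|F|] members and the upshadow of [F0] supplies the
   gain. *)
have [F10|F10] := eqVneq F1 set0.
  have F00 : F0 != set0.
    by rewrite -card_gt0; rewrite -card_gt0 cF F10 cards0 addn0 in Fn0.
  have := upshadow_ge_nonempty F0T F00.
  have : #|F0| <= #|X| by rewrite cX subset_leq_card // subsetUr.
  rewrite cF F10 cards0; lia.
have [A /imsetP[B + _]] := set0Pn _ F10; rewrite inE => /andP[BF xB].
have [s er] : exists s, r = s.+1.
  have /drawsP[_ <-] := subsetP FT _ BF.
  by exists #|B :\ x|; rewrite (cardsD1 x B) xB.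
have F1T : F1 \subset draws (T :\ x) s by apply: link_draws; rewrite -er.
have ltn : #|T :\ x| < n by lia.
have ltr : r.*2 < #|T :\ x| by lia.
have lts : s.*2.+1 < #|T :\ x| by lia.
have le0 := upshadow_expand F0T ltr.
have le1 : #|upshadow (T :\ x) F1| <= #|X| by rewrite cX subset_leq_card // subsetUl.
(* Induction on the link, at rank [s = r - 1], gives the gain [#|T :\ x| - s.+1], which is
   [#|T| - r.+1]. *)
rewrite cF cT er subSS -addnA; apply: leq_trans leX; apply: leq_add le0 _.
exact: leq_trans (IHn _ _ _ ltn F1T F10 lts) le1.
Qed.

(** * Lifting an antichain to a single level *)

Definition antichain F := forall A B, A \in F -> B \in F -> A \subset B -> A = B.

Lemma cross_supersets F G : cross F F ->
  (forall B, B \in G -> exists2 A, A \in F & A \subset B) -> cross G G.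
Proof.
move=> /crossP cF GF; apply/crossP => B1 B2 /GF[A1 A1F /subsetP s1] /GF[A2 A2F /subsetP s2].
by have [x x1 x2] := cF _ _ A1F A2F; exists x; auto.
Qed.

Lemma upshadow_sup T F B : B \in upshadow T F -> exists2 A, A \in F & A \subset B.
Proof. by case/upshadowP=> A [x [AF _ -> _]]; exists A; rewrite ?subsetUr. Qed.

(** Induction on the distance [d] from a lower bound [r] of the sizes to [k]. Replacing the bottom
    level by its upshadow preserves the hypotheses and loses no sets; the gain [#|T| - k] is taken
    from the last round, where [r = k - 1]. *)
Lemma lift_uniform T F k : k.*2 <= #|T| -> cross F F -> antichain F ->
  (forall A, A \in F -> A \subset T /\ #|A| <= k) ->
  (exists2 A, A \in F & #|A| < k) ->
  exists G, [/\ G \subset draws T k, cross G G & #|F| + (#|T| - k) <= #|G|].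
Proof.
move=> kT cF aF FT lowF.
have : exists r d, r + d = k /\ forall A, A \in F -> r <= #|A|.
  by exists 0, k.
case=> r [d]; elim: d r F cF aF FT lowF => [|d IHd] r F cF aF FT lowF [rd rF].
  by have [A AF] := lowF; have := rF A AF; lia.
pose R := [set A in F | #|A| == r].
have FR A : A \in F :\: R -> r < #|A|.
  rewrite !inE negb_and; case AF : (A \in F); rewrite ?andbF //= andbT.
  by rewrite ltn_neqAle eq_sym => ->; apply: rF.
have [R0|Rn0] := eqVneq R set0.
  apply: (IHd r.+1) => //; split; first by rewrite addSnnS.
  by move=> A AF; apply: FR; rewrite R0 setD0.
have RT : R \subset draws T r.
  apply/subsetP=> A; rewrite inE => /andP[AF /eqP cA].
  by apply/drawsP; rewrite cA; have [] := FT _ AF.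
have UT := upshadow_draws RT; set S := upshadow T R in UT.
have cS B : B \in S -> #|B| = r.+1 by move=> /(subsetP UT)/drawsP[].
have RF A : A \in R -> A \in F by rewrite inE => /andP[].
have Rr A : A \in R -> #|A| = r by rewrite inE => /andP[_ /eqP].
have gain : #|R| + (#|T| - r.+1) <= #|S| by apply: upshadow_gain => //; lia.
pose G := (F :\: R) :|: S.
have aFS A B : A \in F :\: R -> B \in S -> B \subset A -> False.
  move=> AFR /upshadow_sup[C CR CB] BA.
  have AF : A \in F by case/setDP: AFR.
  have eCA := aF _ _ (RF _ CR) AF (subset_trans CB BA).
  by have := FR _ AFR; rewrite -eCA Rr // ltnn.
have cG : #|G| = #|F :\: R| + #|S|.
  apply/eqP; rewrite leq_card_setU disjoints_subset; apply/subsetP => A AFR.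
  by rewrite inE; apply/negP => AS; apply: (aFS _ _ AFR AS).
have cFR : #|F| = #|F :\: R| + #|R|.
  rewrite -(cardsID R F) addnC (setIidPr _) //; exact/subsetP.
have leG : #|F| + (#|T| - r.+1) <= #|G|.
  by rewrite cG cFR -addnA leq_add2l.
have iG : cross G G.
  apply: cross_supersets cF _ => B; rewrite inE => /orP[/setDP[BF _]|]; first by exists B.
  by case/upshadow_sup=> A /RF AF AB; exists A.
have GT A : A \in G -> [/\ A \subset T, #|A| <= k & r < #|A|].
  rewrite inE => /orP[AFR|AS].
    by have [] := FT A; [case/setDP: AFR | split=> //; apply: FR].
  have /drawsP[AT cA] := subsetP UT _ AS.
  split=> //; rewrite cA //. lia.
have [d0|dn0] := posnP d.
  have ek : k = r.+1 by lia.
  exists G; split=> //; last by rewrite ek.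
  apply/subsetP=> A /GT[AT Ak rA]; apply/drawsP; split=> //; lia.
(* A shadow set has size [r.+1 < k] and serves as the low set for the next round. *)
have Sn0 : exists B, B \in S.
  apply/set0Pn; rewrite -card_gt0.
  by apply: leq_trans gain; rewrite addn_gt0 card_gt0 Rn0.
have [] := IHd r.+1 G.
- exact: iG.
- move=> A B AG BG AB; apply/eqP; rewrite eqEcard AB /=.
  move: BG; rewrite inE => /orP[BFR|/cS->]; last by case: (GT _ AG).
  move: (AG); rewrite inE => /orP[AFR|AS]; last by case: (aFS _ _ BFR AS).
  by case/setDP: AFR BFR => AF _ /setDP[BF _]; rewrite (aF A B).
- by move=> A /GT[].
- by have [B BS] := Sn0; exists B; [rewrite in_setU BS orbT | rewrite cS //; lia].
- split; first lia.
  by move=> A /GT[].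
- move=> H [H1 H2 H3]; exists H; split=> //; apply: leq_trans H3.
  rewrite leq_add2r; apply: leq_trans leG.
  exact: leq_addr.
Qed.

(** * Intersecting families of half-size sets *)

Lemma bin_half k : 0 < k -> 'C(k.*2, k) = ('C(k.*2.-1, k.-1)).*2.
Proof.
case: k => // k _; rewrite doubleS /= binS.
have <- : 'C(k.*2.+1, k.*2.+1 - k.+1) = 'C(k.*2.+1, k.+1) by apply: bin_sub; lia.
have -> : k.*2.+1 - k.+1 = k by lia.
by rewrite addnn.
Qed.

Lemma cross_self_gt0 F A : cross F F -> A \in F -> 0 < #|A|.
Proof.
by move=> /crossP cF AF; have [x xA _] := cF _ _ AF AF; rewrite (cardsD1 x) xA.
Qed.

(** A set and its complement are never both in [F], so [F] has at most half of all [k]-subsets. *)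
Lemma intersecting_double T F k : #|T| = k.*2 -> F \subset draws T k ->
  0 < k -> cross F F -> #|F| <= 'C(k.*2.-1, k.-1).
Proof.
move=> cT FT k0 /crossP cF; pose C := [set T :\: A | A in F].
have FTP A : A \in F -> A \subset T /\ #|A| = k by move/(subsetP FT)/drawsP.
have TDK A : A \in F -> T :\: (T :\: A) = A.
  by move=> /FTP[/setIidPr AT _]; rewrite setDDr setDv set0U AT.
have cC : #|C| = #|F|.
  by apply: card_in_imset => A B /TDK eA /TDK eB e; rewrite -eA e eB.
have CT : C \subset draws T k.
  apply/subsetP => _ /imsetP[A /FTP[AT cA] ->]; apply/drawsP.
  by rewrite subsetDl cardsDS // cT cA; split=> //; lia.
rewrite -leq_double -bin_half // -cT -cards_draws -addnn -[in X in _ + X]cC.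
have /eqP <- : #|F :|: C| == #|F| + #|C|.
  rewrite leq_card_setU disjoints_subset; apply/subsetP => A AF.
  rewrite inE; apply/negP => /imsetP[B BF eA].
  have [x xA xB] := cF _ _ AF BF.
  by move: xA; rewrite eA inE xB.
by rewrite subset_leq_card // subUset FT CT.
Qed.

(** * Pairs of cross-intersecting families *)

Lemma mem_tperm_imset x y z A :
  (z \in [set tperm x y u | u in A]) = (tperm x y z \in A).
Proof. by rewrite -{1}(tpermK x y z) mem_imset //; apply: perm_inj. Qed.

Lemma tperm_imset_fix x y A : (x \in A) = (y \in A) ->
  [set tperm x y u | u in A] = A.
Proof.
move=> eA; apply/setP => z; rewrite mem_tperm_imset.
by case: tpermP => // ->.
Qed.

Lemma tperm_imset_swap x y A : x \in A -> y \notin A ->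
  [set tperm x y u | u in A] = y |: A :\ x.
Proof.
move=> xA yA; apply/setP => z; rewrite mem_tperm_imset !inE.
case: tpermP => [->|->|/eqP zx /eqP zy].
- by rewrite eqxx (negPf yA) /= orbF; apply/esym/negP => /eqP exy; rewrite -exy xA in yA.
- by rewrite eqxx xA.
- by rewrite (negPf zy) zx.
Qed.

Definition act (s : {perm U}) P := [set [set s u | u in A] | A : {set U} in P].

Lemma act_set_inj (s : {perm U}) : injective (fun A : {set U} => [set s u | u in A]).
Proof. exact/imset_inj/perm_inj. Qed.

Lemma actM (s t : {perm U}) P : act (s * t)%g P = act t (act s P).
Proof.
rewrite /act -imset_comp; apply: eq_imset => A /=.
by rewrite -imset_comp; apply: eq_imset => x; rewrite permM.
Qed.

Lemma card_act s P : #|act s P| = #|P|.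
Proof. exact/card_imset/act_set_inj. Qed.

Lemma cross_act s P Q : cross P Q -> cross (act s P) (act s Q).
Proof.
move=> /crossP cPQ; apply/crossP => _ _ /imsetP[A AP ->] /imsetP[B BQ ->].
by have [x xA xB] := cPQ _ _ AP BQ; exists (s x); apply: imset_f.
Qed.

Lemma act_tperm_draws x y T P r : x \in T -> y \in T -> P \subset draws T r ->
  act (tperm x y) P \subset draws T r.
Proof.
move=> xT yT PT; apply/subsetP => _ /imsetP[A AP ->].
have /drawsP[AT cA] := subsetP PT _ AP; apply/drawsP; split; last first.
  by rewrite card_imset //; apply: perm_inj.
by rewrite -(@tperm_imset_fix x y T) ?xT // imsetS.
Qed.

(** For [#|T| = r.*2.+1], complementing the members of one family turns disjointness into inclusion
    between levels [r] and [r.+1]: such a pair is an independent set of the middle-levels graph that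
    meets both sides. *)
Definition cross_pair T r (p : {set {set U}} * {set {set U}}) :=
  [&& p.1 \subset draws T r, p.2 \subset draws T r, p.1 != set0, p.2 != set0
    & cross p.1 p.2].

(* Blocks of imprimitivity: uncrossing a maximum pair [(P, Q)] with its image
   under a permutation [s] shows that [P] and its image are equal or disjoint,
   when [P] is as small as possible. *)
Lemma extremal_pair_block T r P Q x y A :
  cross_pair T r (P, Q) ->
  (forall p, cross_pair T r p -> #|p.1| + #|p.2| <= #|P| + #|Q|) ->
  (forall p, cross_pair T r p -> #|p.1| + #|p.2| = #|P| + #|Q| -> #|P| <= #|p.1|) ->
  x \in T -> y \in T -> A \in P -> [set tperm x y u | u in A] \in P ->
  act (tperm x y) P = P.
Proof.
move=> gPQ maxPQ minPQ xT yT AP sAP; have /and5P[/= PT QT Pn0 Qn0 cPQ] := gPQ.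
pose P' := act (tperm x y) P; pose Q' := act (tperm x y) Q.
have P'T : P' \subset draws T r by apply: act_tperm_draws.
have Q'T : Q' \subset draws T r by apply: act_tperm_draws.
have cPQ' : cross P' Q' by apply: cross_act.
have lePQ : #|P| <= #|Q|.
  by apply: (minPQ (Q, P)); rewrite /= 1?addnC // /cross_pair /= cross_sym; apply/and5P.
have eP := cardsUI P P'; have eQ := cardsUI Q Q'; rewrite !card_act in eP eQ.
have In0 : 0 < #|P :&: P'|.
  by rewrite card_gt0; apply/set0Pn; exists [set tperm x y u | u in A]; rewrite inE sAP imset_f.
have g1 : cross_pair T r (P :&: P', Q :|: Q').
  apply/and5P; split=> /=.
  - by rewrite subIset ?PT.
  - by rewrite subUset QT.
  - by rewrite -card_gt0.
  - by rewrite -card_gt0 (leq_trans _ (subset_leq_card (subsetUl _ _))) ?card_gt0.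
  - apply/crossP => B C; rewrite !inE => /andP[BP BP'] /orP[CQ|CQ].
      exact: (crossP _ _ cPQ).
    exact: (crossP _ _ cPQ').
have m1 := maxPQ _ g1; rewrite /= in m1.
have g2 : cross_pair T r (P :|: P', Q :&: Q').
  apply/and5P; split=> /=.
  - by rewrite subUset PT.
  - by rewrite subIset ?QT.
  - by rewrite -card_gt0 (leq_trans _ (subset_leq_card (subsetUl _ _))) ?card_gt0.
  (* If [Q :&: Q'] were empty, the first pair would have total size above [2 * #|Q|], hence above
     the maximum. *)
  - rewrite -card_gt0; move: In0 m1 eQ lePQ; clear.
    move: #|_ :&: _| #|_ :|: _| #|_ :&: _| #|P| #|Q| => a b c p q; lia.
  - apply/crossP => B C; rewrite !inE => /orP[BP|BP] /andP[CQ CQ'].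
      exact: (crossP _ _ cPQ).
    exact: (crossP _ _ cPQ').
have m2 := maxPQ _ g2; rewrite /= in m2.
(* The total sizes of the two new pairs add up to twice the maximum, so both are maximum and the
   minimality of [#|P|] applies to the first. *)
have m3 : #|P| <= #|P :&: P'|.
  apply: (minPQ _ g1) => /=.
  move: m1 m2 eQ eP; clear; move: #|_ :&: _| #|_ :|: _| #|_ :&: _| #|_ :|: _| #|P| #|Q| => a b c d p q; lia.
have PI : P :&: P' = P by apply/eqP; rewrite eqEcard subsetIl.
by apply/esym/eqP; rewrite eqEcard card_act leqnn andbT; apply/setIidPl.
Qed.

(** The single member [A] of [P] excludes from [Q] the [r.+1] subsets of size [r] of [T :\: A]. *)
Lemma cross_pair_bound_singleton T r P Q : cross_pair T r (P, Q) ->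
  #|T| = r.*2.+1 -> #|P| = 1 -> #|P| + #|Q| + r <= 'C(r.*2.+1, r).
Proof.
move=> /and5P[/= PT QT _ _ /crossP cPQ] cT /[dup] cP ->.
have [A eP] := cards1P (introT eqP cP).
have AP : A \in P by rewrite eP set11.
have /drawsP[AT cA] := subsetP PT _ AP.
rewrite -cT -cards_draws.
have cE : #|draws (T :\: A) r| = r.+1.
  rewrite cards_draws cardsDS // cT cA.
  have -> : r.*2.+1 - r = r.+1 by lia.
  exact: binSn.
suff /eqP e : #|Q :|: draws (T :\: A) r| == #|Q| + #|draws (T :\: A) r|.
  rewrite add1n addSn -addnS -cE -e; apply: subset_leq_card.
  rewrite subUset QT; apply/subsetP => B /drawsP[BTA cB]; apply/drawsP; split=> //.
  exact: subset_trans BTA (subsetDl _ _).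
rewrite leq_card_setU disjoints_subset; apply/subsetP => B BQ; rewrite inE.
apply/negP=> /drawsP[+ _]; rewrite subsetD disjoint_sym => /andP[_ dAB].
have [x xA xB] := cPQ _ _ AP BQ.
by rewrite (disjointFr dAB xA) in xB.
Qed.
(** Among the pairs of maximum total size one with the smallest first family is taken. If that
    family has two members, the block property makes it invariant under all transpositions of points
    of [T], which is absurd. *)
Theorem cross_pair_bound T r P Q : cross_pair T r (P, Q) -> #|T| = r.*2.+1 ->
  #|P| + #|Q| + r <= 'C(r.*2.+1, r).
Proof.
move=> gPQ0 cT; pose w (p : {set {set U}} * {set {set U}}) := #|p.1| + #|p.2|.
case: (arg_maxnP w gPQ0) => M gM maxM.
have gM' : cross_pair T r M && (w M == w M) by rewrite gM eqxx.
case: (@arg_minnP _ M (fun p => cross_pair T r p && (w p == w M)) (fun p => #|p.1|) gM').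
case=> P1 Q1 /andP[g1 /eqP e1] min1.
have := maxM _ gPQ0; rewrite -e1 /w /= => le01.
apply: leq_trans (leq_add le01 (leqnn r)) _ => {le01 gPQ0 P Q gM'}.
have max1 p : cross_pair T r p -> #|p.1| + #|p.2| <= #|P1| + #|Q1|.
  by move/maxM; rewrite -e1.
have min1' p : cross_pair T r p -> #|p.1| + #|p.2| = #|P1| + #|Q1| -> #|P1| <= #|p.1|.
  by move=> gp ep; apply: min1; rewrite gp -e1 /w /= ep eqxx.
have /and5P[/= PT QT Pn0 Qn0 /crossP cPQ] := g1.
have [c1|c1] := eqVneq #|P1| 1; first exact: cross_pair_bound_singleton g1 cT c1.
have [A [B [AP BP AB]]] : exists A B, [/\ A \in P1, B \in P1 & A != B].
  have : 1 < #|P1| by rewrite ltn_neqAle eq_sym c1 card_gt0.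
  by case/card_gt1P=> A [B [? ? ?]]; exists A, B.
(* Such a transposition fixes [C], so [P1] and its image share [C] and must coincide. *)
have stab C x y : C \in P1 -> x \in T -> y \in T -> (x \in C) = (y \in C) ->
    act (tperm x y) P1 = P1.
  move=> CP xT yT exy; apply: (extremal_pair_block g1 max1 min1' xT yT CP).
  by rewrite tperm_imset_fix.
have trans z x y : act (tperm z x) P1 = P1 -> act (tperm z y) P1 = P1 ->
    act (tperm x y) P1 = P1.
  move=> hx hy; have [-> //|yx] := eqVneq x y.
    by rewrite tperm1; rewrite -[RHS]hy -[in RHS]hy -actM tperm2.
  have [-> //|zy] := eqVneq y z; first by rewrite tpermC.
  have [-> //|zx] := eqVneq x z.
  have -> : tperm x y = (tperm z x * tperm z y * tperm z x)%g.
    have := tpermJ z y (tperm z x); rewrite tpermL tpermD // 1?eq_sym // => <-.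
    by rewrite conjgE tpermV mulgA.
  by rewrite !actM hx hy hx.
have /drawsP[AT cA] := subsetP PT _ AP; have /drawsP[BT cB] := subsetP PT _ BP.
(* For disjoint [A] and [B], [z] is taken outside both, and every [x] is outside one of them.
   Otherwise [z] is taken in both, and a point [a] of [A] outside [B] links [z] to any [x] outside
   both. *)
have [z zT hub] : exists2 z, z \in T & forall x, x \in T -> act (tperm z x) P1 = P1.
  have [AB0|[z]] := set_0Vmem (A :&: B).
    have [z] : exists z, z \in T :\: (A :|: B).
      apply/set0Pn; rewrite -card_gt0 cardsDS ?subUset ?AT // cT cardsU cA cB AB0.
      by rewrite cards0 subn0 addnn subSnn.
    rewrite !inE negb_or => /andP[/andP[zA zB] zT]; exists z => // x xT.
    have [xA|xA] := boolP (x \in A); last first.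
      by apply: (stab A) => //; rewrite (negPf zA) (negPf xA).
    apply: (stab B) => //; rewrite (negPf zB); apply/esym/negP => xB.
    by have := in_set0 x; rewrite -AB0 inE xA xB.
  rewrite inE => /andP[zA zB]; have zT := subsetP AT _ zA.
  have [a] : exists a, a \in A :\: B.
    apply/set0Pn; rewrite setD_eq0; apply: contra AB => sAB.
    by rewrite eqEcard sAB cA cB leqnn.
  rewrite inE => /andP[aB aA]; have aT := subsetP AT _ aA.
  exists z => // x xT.
  have [xA|xA] := boolP (x \in A); first by apply: (stab A); rewrite ?zA ?xA.
  have [xB|xB] := boolP (x \in B); first by apply: (stab B); rewrite ?zB ?xB.
  apply: (trans a); [rewrite tpermC|]; [apply: (stab A)|apply: (stab B)] => //.
  - by rewrite zA aA.
  - by rewrite (negPf aB) (negPf xB).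
have [C CQ] := set0Pn _ Qn0; have /drawsP[CT cC] := subsetP QT _ CQ.
(* Exchanging a point common to [D] and [C] for a point outside both stays in [P1] and shrinks the
   smallest intersection. *)
case: (@arg_minnP _ A (mem P1) (fun D => #|D :&: C|) AP) => D DP minD.
have /drawsP[DT cD] := subsetP PT _ DP.
have [x xD xC] := cPQ _ _ DP CQ.
have [y] : exists y, y \in T :\: (D :|: C).
  have : 0 < #|D :&: C| by rewrite card_gt0; apply/set0Pn; exists x; rewrite inE xD.
  move=> I0; apply/set0Pn; rewrite -card_gt0 cardsDS ?subUset ?DT // cT cardsU cD cC.
  move: I0; move: #|_ :&: _|; clear; lia.
rewrite !inE negb_or => /andP[/andP[yD yC] yT]; have xT := subsetP DT _ xD.
have swP : y |: D :\ x \in P1.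
  by rewrite -(tperm_imset_swap xD yD) -(trans z x y (hub _ xT) (hub _ yT)) imset_f.
have := minD _ swP; rewrite leqNgt => /negP[]; apply: proper_card.
apply/properP; split.
  apply/subsetP => u; rewrite !inE => /andP[/orP[/eqP ->|/andP[_ ->] -> //]].
  by rewrite (negPf yC).
exists x; rewrite !inE ?xD // eqxx orbF negb_and.
by apply/orP; left; apply/negP => /eqP exy; rewrite -exy xD in yD.
Qed.
(** With [x] and [y] removed, the sets containing exactly one of them give a cross-intersecting pair
    of families of [(k-1)]-subsets of [2k-1] points; those containing both give [(k-2)]-subsets.
    Pascal's rule adds up the two bounds. *)
Lemma two_point_bound T F k x y : #|T| = k.*2.+1 -> F \subset draws T k ->
  cross F F -> x \in T -> y \in T -> x != y ->
  (forall A, A \in F -> (x \in A) || (y \in A)) ->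
  (exists2 A, A \in F & x \notin A) -> (exists2 A, A \in F & y \notin A) ->
  #|F| + k <= ('C(k.*2, k.-1)).+1.
Proof.
move=> cT FT /crossP cF xT yT xy Fxy [A AF xA] [B BF yB].
have yA : y \in A by have := Fxy A AF; rewrite (negPf xA).
have xB : x \in B by have := Fxy B BF; rewrite (negPf yB) orbF.
have [s ek] : exists s, k = s.+2.
  have [z zA zB] := cF _ _ AF BF; have /drawsP[_ <-] := subsetP FT _ AF.
  exists #|A :\ y :\ z|; rewrite (cardsD1 y) yA (cardsD1 z (A :\ y)) !inE zA.
  by rewrite (_ : z != y) //; apply: contra yB => /eqP <-.
move: cT FT; rewrite {k}ek => cT FT.
have LT := link_draws x FT; have DT := deletion_draws x FT.
set T' := T :\ x :\ y.
have cT' : #|T'| = s.+1.*2.+1.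
  have := cT; rewrite (cardsD1 x) xT (cardsD1 y (T :\ x)) in_setD1 yT eq_sym xy /= -/T'.
  by rewrite !add1n doubleS => -[].
pose P := deletion y (link x F); pose Q := link y (deletion x F).
have g : cross_pair T' s.+1 (P, Q).
  apply/and5P; split=> /=; [exact: deletion_draws|exact: link_draws| | |].
  - apply/set0Pn; exists (B :\ x); rewrite inE !inE negb_and yB orbT andbT.
    by apply/linkP; rewrite setD11 setD1K.
  - apply/set0Pn; exists (A :\ y); apply/linkP.
    by rewrite setD11 setD1K // inE AF.
  - apply/crossP => C D; rewrite inE => /andP[/linkP[xC CF] yC] /linkP[yD].
    rewrite inE !inE negb_or => /andP[DF /andP[_ xD]].
    have [z] := cF _ _ CF DF; rewrite !inE => /orP[/eqP->|zC] /orP[/eqP e|zD].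
    - by rewrite e eqxx in xy.
    - by rewrite (negPf xD) in zD.
    - by rewrite -e zC in yC.
    - by exists z.
have bPQ := cross_pair_bound g cT'.
have bL : #|link y (link x F)| <= 'C(s.+1.*2.+1, s).
  by rewrite -cT' -cards_draws subset_leq_card // (link_draws y LT).
have d0 : #|deletion y (deletion x F)| = 0.
  apply/eqP; rewrite cards_eq0; apply/eqP/setP => C; rewrite !inE.
  by apply/negP => /andP[/andP[/Fxy/orP[->//|->] _]].
rewrite (card_split x F) (card_split y (link x F)) (card_split y (deletion x F)) d0 add0n.
rewrite -/P -/Q doubleS binS.
move: bPQ bL; clear; move: #|P| #|Q| #|_| => a b c; lia.
Qed.
End SetFamilies.

(** * Shifted families *)

Section Shifted.
Variable N : nat.
Implicit Types (A B K : {set 'I_N}) (F : {set {set 'I_N}}) (i j : 'I_N).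

(** Ground sets are initial segments of a fixed ['I_N], so that induction can drop the last point
    without changing the type. *)
Definition below n : {set 'I_N} := [set i : 'I_N | i < n].

Lemma card_below n : n <= N -> #|below n| = n.
Proof.
move=> nN; have inj : injective (widen_ord nN).
  by move=> i j /(congr1 val)/= eij; apply: val_inj.
rewrite -[RHS]card_ord -(card_imset _ inj).
apply: eq_card => i; rewrite inE; apply/idP/imsetP => [lt_in|[j _ ->]]; last exact: (ltn_ord j).
by exists (Ordinal lt_in); rewrite ?inE //; apply: val_inj.
Qed.

Lemma belowD1 n (nN : n < N) : below n.+1 :\ Ordinal nN = below n.
Proof. by apply/setP => i; rewrite !inE -val_eqE /= ltnS [RHS]ltn_neqAle. Qed.

Definition shifted F := forall A i j, A \in F -> i < j -> j \in A -> i \notin A ->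
  i |: A :\ j \in F.

(** A potential: moving a point down lowers it strictly, which yields minimal members and the
    termination of shifting. *)
Definition weight A := \sum_(i in A) i.

Lemma weight_swap A i j : i \notin A -> j \in A -> weight (i |: A :\ j) + j = weight A + i.
Proof.
move=> iA jA; rewrite /weight big_setU1 /= ?inE ?(negPf iA) ?andbF //.
by rewrite [in RHS](big_setD1 j) //= -addnA addnC [_ + (j : nat)]addnC.
Qed.

(** For [k = 1], a singleton avoiding [0] could be shifted to the singleton of [0], disjoint from
    it. *)
Lemma shifted_pos_gt1 F k A : F \subset draws [set: 'I_N] k -> cross F F -> shifted F ->
  A \in F -> (forall i, i \in A -> 0 < i) -> 1 < k.
Proof.
move=> FT cF sF AF posA; have /drawsP[_ <-] := subsetP FT _ AF.
rewrite ltn_neqAle eq_sym (cross_self_gt0 cF AF) andbT.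
apply/negP => /cards1P[a eA].
have a0 : 0 < a by apply: posA; rewrite eA set11.
pose o : 'I_N := Ordinal (leq_ltn_trans (leq0n a) (ltn_ord a)).
have oA : o \notin A by apply/negP => /posA.
have oF : o |: A :\ a \in F by apply: sF => //; rewrite eA set11.
have [z] := crossP _ _ cF _ _ oF AF.
rewrite in_setU1 in_setD1 => /orP[/eqP->|/andP[za]]; first by rewrite (negPf oA).
by rewrite eA inE (negPf za).
Qed.

(** In a member of least weight among those avoiding [0], no point can move down to a free positive
    position. *)
Lemma shifted_initial F k A : k < N -> F \subset draws [set: 'I_N] k -> shifted F ->
  A \in F -> (forall i, i \in A -> 0 < i) -> [set i : 'I_N | 0 < i <= k] \in F.
Proof.
move=> kN FT sF AF posA; set K := [set _ | _].
pose pos B := [forall i in B, 0 < i].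
have pA : (A \in F) && pos A by rewrite AF; apply/forall_inP.
case: (@arg_minnP _ A (fun B => (B \in F) && pos B) weight pA) => D /andP[DF pD] minD.
have /drawsP[_ cD] := subsetP FT _ DF.
pose o : 'I_N := Ordinal (leq_ltn_trans (leq0n k) kN).
have cK : #|K| = k.
  have oK : o \in below k.+1 by rewrite inE.
  have cb := card_below kN; rewrite (cardsD1 o) oK add1n in cb; case: cb => <-.
  by apply: eq_card => i; rewrite !inE -val_eqE /= lt0n.
have [DK|] := boolP (D \subset K).
  by rewrite (_ : K = D) //; apply/esym/eqP; rewrite eqEcard DK cD cK leqnn.
move/subsetPn=> [j jD]; rewrite inE (forall_inP pD _ jD) /= -ltnNge => kj.
have [i] : exists i, i \in K :\: D.
  apply/set0Pn; rewrite setD_eq0; apply/negP => KD.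
  have eKD : K = D by apply/eqP; rewrite eqEcard KD cD cK leqnn.
  by move: jD; rewrite -eKD inE [_ <= k]leqNgt kj andbF.
rewrite !inE => /and3P[iD i0 ik].
have ij : i < j by apply: leq_ltn_trans kj.
have : weight D <= weight (i |: D :\ j).
  apply: minD; rewrite sF //=; apply/forall_inP => u; rewrite !inE => /orP[/eqP->//|/andP[_]].
  exact: (forall_inP pD).
have := weight_swap iD jD; rewrite leqNgt => e /negP[].
by rewrite -(ltn_add2r j) e ltn_add2l.
Qed.

Lemma setU1D1 (V : finType) (x y : V) (A : {set V}) : x != y ->
  x |: A :\ y = (x |: A) :\ y.
Proof.
move=> xy; apply/setP => z; rewrite !inE.
by have [->|//] := eqVneq z x; rewrite xy.
Qed.

(** Induction on [n], splitting at the last point [l]. The deletion still contains the set of [1] to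
    [k], and the link is again shifted and intersecting; the link is bounded directly if all its
    members contain [0], by induction otherwise. *)
Lemma shifted_hilton_milner n k F A : n <= N -> k.*2 <= n ->
  F \subset draws (below n) k -> shifted F -> cross F F ->
  A \in F -> (forall i, i \in A -> 0 < i) ->
  #|F| + 'C(n - k.+1, k.-1) <= ('C(n.-1, k.-1)).+1.
Proof.
have subT m h (G : {set {set 'I_N}}) : G \subset draws (below m) h -> G \subset draws [set: 'I_N] h.
  move=> GT; apply: (subset_trans GT); apply/subsetP => B /drawsP[_ <-].
  by apply/drawsP; rewrite subsetT.
elim: n k F A => [|n IHn] k F A nN kn FT sF cF AF posA.
  have /drawsP[_ cA] := subsetP FT _ AF.
  by have := cross_self_gt0 cF AF; rewrite cA; lia.
have k1 := shifted_pos_gt1 (subT _ _ _ FT) cF sF AF posA.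
case: (ltngtP k.*2 n.+1) kn => // [kn _|kn _]; last first.
  (* Here the subtracted coefficient is ['C(k.-1, k.-1) = 1], and the bound by complements
     suffices. *)
  have cb : #|below n.+1| = k.*2 by rewrite card_below.
  have := intersecting_double cb FT (ltnW k1) cF; rewrite kn /=.
  have -> : n.+1 - k.+1 = k.-1 by lia.
  by rewrite binn addn1 ltnS.
case: k k1 FT kn => [|[|k]] // _ FT kn /=.
pose l : 'I_N := Ordinal nN.
have F0T : deletion l F \subset draws (below n) k.+2.
  by rewrite -(belowD1 nN); apply: deletion_draws.
have F1T : link l F \subset draws (below n) k.+1.
  by rewrite -(belowD1 nN); apply: link_draws.
have neq_l B i j : B \in F -> i < j -> j \in B -> i != l.
  move=> BF ij jB; have /drawsP[/subsetP/(_ j jB) + _] := subsetP FT _ BF.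
  by rewrite inE ltnS -val_eqE /= => jn; rewrite ltn_eqF ?(leq_trans ij).
have sF0 : shifted (deletion l F).
  move=> B i j; rewrite !inE => /andP[BF lB] ij jB iB.
  rewrite (sF _ _ _ BF ij jB iB) /= negb_or negb_and lB orbT andbT eq_sym.
  exact: neq_l BF ij jB.
have cF0 : cross (deletion l F) (deletion l F).
  by apply/crossP => B C; rewrite !inE => /andP[BF _] /andP[CF _]; apply: (crossP _ _ cF).
have sF1 : shifted (link l F).
  move=> B i j /linkP[lB BF] ij jB iB.
  have jl : j != l by apply: contra lB => /eqP <-.
  have il : i != l.
    by apply: neq_l BF ij _; rewrite !inE jB orbT.
  apply/linkP; split; first by rewrite !inE negb_or negb_and eq_sym il lB orbT.
  rewrite setUCA setU1D1 1?eq_sym //; apply: sF => //; first by rewrite !inE jB orbT.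
  by rewrite !inE negb_or il.
(* Two disjoint traces leave a free point [i] below [l]; shifting [l] to [i] in one of the two sets
   would make them disjoint. *)
have cF1 : cross (link l F) (link l F).
  apply/crossP => B C BF1 CF1.
  have [/setP BC0|[z]] := set_0Vmem (B :&: C); last first.
    by rewrite inE => /andP[zB zC]; exists z.
  have /drawsP[BT cB] := subsetP F1T _ BF1; have /drawsP[CT cC] := subsetP F1T _ CF1.
  have [i] : exists i, i \in below n :\: (B :|: C).
    apply/set0Pn; rewrite -card_gt0 cardsDS ?subUset ?BT // card_below ?(ltnW nN) //.
    by rewrite cardsU cB cC; move: kn; clear; lia.
  rewrite !inE negb_or => /andP[/andP[iB iC] ltin].
  have /linkP[lB BF] := BF1; have /linkP[lC CF] := CF1.
  have il : i != l by rewrite -val_eqE /= ltn_eqF.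
  have iBF : i |: (l |: B) :\ l \in F.
    by apply: sF => //; rewrite ?setU11 // !inE negb_or il.
  have [z] := crossP _ _ cF _ _ iBF CF.
  rewrite setU1K // !inE => /orP[/eqP->|zB] /orP[/eqP e|zC].
  - by rewrite e eqxx in il.
  - by rewrite zC in iC.
  - by rewrite -e zB in lB.
  - by have := BC0 z; rewrite !inE zB zC.
set K := [set i : 'I_N | 0 < i <= k.+2].
have KF : K \in F.
  by apply: shifted_initial AF posA => //; [lia | apply: subT FT].
have lK : l \notin K by rewrite inE negb_and -ltnNge /=; apply/orP; right; move: kn; clear; lia.
have KF0 : K \in deletion l F by rewrite inE KF.
have posK i : i \in K -> 0 < i by rewrite inE => /andP[].
have kn' : k.+2.*2 <= n by [].
have b0 := IHn k.+2 _ _ (ltnW nN) kn' F0T sF0 cF0 KF0 posK.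
rewrite (card_split l).
have [m en] : exists m, n = m + k.+3.
  by exists (n - k.+3); rewrite subnK //; move: kn; clear; lia.
have em : n - k.+3 = m by rewrite en addnK.
have em2 : n - k.+2 = m.+1 by rewrite en; clear; lia.
have em1 : n.+1 - k.+3 = m.+1 by rewrite en; clear; lia.
have en1 : n.-1 = m + k.+2 by rewrite en addnS.
have km : k < m by move: kn; rewrite en; clear; lia.
rewrite em en1 /= in b0; rewrite em1 en addnS !binS.
pose o : 'I_N := Ordinal (leq_ltn_trans (leq0n n) nN).
(* If every trace contains [0], removing it leaves [k]-sets that still meet [K]; this excludes the
   ['C(m, k)] subsets of [T :\: K]. *)
have [alls|] := boolP [forall B in link l F, o \in B].
  have d0 : #|deletion o (link l F)| = 0.
    apply/eqP; rewrite cards_eq0; apply/eqP/setP => B; rewrite in_set0 inE.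
    by apply/negP => /andP[/(forall_inP alls) ->].
  rewrite (card_split o (link l F)) d0 add0n.
  pose T := below n :\ o.
  have oT : o \in below n by rewrite inE /=; move: kn; clear; lia.
  have cT : #|T| = m + k.+2.
    have cb := card_below (ltnW nN); rewrite (cardsD1 o) oT add1n in cb.
    by apply: succn_inj; rewrite -addnS; apply: etrans cb en.
  have KT : K \subset T.
    have /drawsP[KT _] := subsetP F0T _ KF0.
    by rewrite subsetD1 KT inE.
  have cK : #|K| = k.+2 by have /drawsP[] := subsetP F0T _ KF0.
  have cD : #|draws (T :\: K) k| = 'C(m, k).
    by rewrite cards_draws cardsDS // cT cK addnK.
  have b1 : #|link o (link l F)| + 'C(m, k) <= 'C(m + k.+2, k).
    have /eqP <- : #|link o (link l F) :|: draws (T :\: K) k| ==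
        #|link o (link l F)| + 'C(m, k).
      rewrite -cD leq_card_setU disjoints_subset; apply/subsetP => B.
      move=> /linkP[oB /linkP[lB BF]]; rewrite inE; apply/negP => /drawsP[BTK _].
      have [z] := crossP _ _ cF _ _ BF KF.
      rewrite !in_setU1 => /or3P[/eqP ->|/eqP ->|zB] zK.
      - by rewrite zK in lK.
      - by have := posK _ zK.
      - by have := subsetP BTK _ zB; rewrite inE zK.
    rewrite -cT -cards_draws; apply: subset_leq_card.
    rewrite subUset link_draws //; apply/subsetP => B /drawsP[BTK cB].
    by apply/drawsP; split=> //; apply: subset_trans BTK (subsetDl _ _).
  move: b0 b1; clear; move: #|_| #|_| 'C(_, _) 'C(_, _) 'C(_, _) 'C(_, _) => a b c d e f; lia.
rewrite negb_forall_in => /exists_inP[A1 A1F oA1].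
have posA1 i : i \in A1 -> 0 < i.
  move=> iA1; rewrite lt0n; apply: contra oA1 => /eqP i0.
  by rewrite (_ : o = i) //; apply: val_inj.
have k0 := shifted_pos_gt1 (subT _ _ _ F1T) cF1 sF1 A1F posA1.
have kn1 : k.+1.*2 <= n by move: kn; clear; lia.
have := IHn k.+1 _ _ (ltnW nN) kn1 F1T sF1 cF1 A1F posA1.
case: k k0 b0 km {FT kn F0T F1T K KF lK KF0 posK em em1 en kn' kn1} em2 en1 => // k _ b0 km em2 en1.
rewrite em2 en1 binS.
(* Adding the two induction bounds leaves an excess of one, which this coefficient absorbs. *)
have : 0 < 'C(m, k) by rewrite bin_gt0; move: km; clear; lia.
move: b0; clear; rewrite /=.
move: #|_| #|_| 'C(_, _) 'C(_, _) 'C(_, _) 'C(_, _) 'C(_, _) => a b c d e f g; lia.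
Qed.
End Shifted.

(** * Shifting *)

Section Shifting.
Variable N : nat.
Implicit Types (A B : {set 'I_N}) (F : {set {set 'I_N}}) (i j : 'I_N).

(** This is the compression of Erdos, Ko and Rado; requiring the image to lie outside [F] makes
    [shift] injective on [F]. *)
Definition movable F i j A := [&& j \in A, i \notin A & i |: A :\ j \notin F].

Definition shift F i j A := if movable F i j A then i |: A :\ j else A.

Definition shift_family F i j := [set shift F i j A | A in F].

Variant shift_spec F i j A : {set 'I_N} -> Prop :=
| ShiftMoved of j \in A & i \notin A & i |: A :\ j \notin F :
    shift_spec F i j A (i |: A :\ j)
| ShiftFixed of (j \in A -> i \notin A -> i |: A :\ j \in F) :
    shift_spec F i j A A.

Lemma shiftP F i j A : shift_spec F i j A (shift F i j A).
Proof.
rewrite /shift /movable; case: and3P => [[]|h]; first by constructor.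
by constructor=> jA iA; apply/negPn/negP => nF; apply: h.
Qed.

Lemma swapK i j A : j \in A -> i \notin A -> j |: (i |: A :\ j) :\ i = A.
Proof.
by move=> jA iA; rewrite setU1K ?setD1K // !inE negb_and iA orbT.
Qed.

Lemma shift_inj F i j : {in F &, injective (shift F i j)}.
Proof.
move=> A B AF BF; case: shiftP => [jA iA nA|_]; case: shiftP => [jB iB nB|_] // e.
- by rewrite -(swapK jA iA) e swapK.
- by rewrite e BF in nA.
- by rewrite -e AF in nB.
Qed.

Lemma card_shift_family F i j : #|shift_family F i j| = #|F|.
Proof. exact/card_in_imset/shift_inj. Qed.

Lemma shift_family_draws F i j k : F \subset draws [set: 'I_N] k ->
  shift_family F i j \subset draws [set: 'I_N] k.
Proof.
move=> FT; apply/subsetP => _ /imsetP[A /(subsetP FT)/drawsP[_ cA] ->].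
apply/drawsP; split; first exact: subsetT.
case: shiftP => // jA iA _; rewrite cardsU1 !inE negb_and iA orbT.
by rewrite -cA [in RHS](cardsD1 j) jA.
Qed.

(** Two moved sets share [i]. If a fixed set has [j] but not [i], its swapped copy is already in
    [F], and a point where that copy meets a moved set's original is neither [i] nor [j], so it
    survives. *)
Lemma shift_family_cross F i j : cross F F ->
  cross (shift_family F i j) (shift_family F i j).
Proof.
move=> /crossP cF.
have moved_fixed A B : A \in F -> B \in F -> j \in A -> i \notin A ->
    (j \in B -> i \notin B -> i |: B :\ j \in F) ->
    exists2 z, z \in i |: A :\ j & z \in B.
  move=> AF BF jA iA hB.
  have [iB|iB] := boolP (i \in B); first by exists i; rewrite ?setU11.
  have [jB|jB] := boolP (j \in B).
    have [z zA] := cF _ _ AF (hB jB iB).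
    rewrite !inE => /orP[/eqP zi|/andP[zj zB]]; first by rewrite -zi zA in iA.
    by exists z; rewrite // !inE zj zA orbT.
  have [z zA zB] := cF _ _ AF BF; exists z => //.
  by rewrite !inE zA andbT (_ : z != j) ?orbT //; apply: contra jB => /eqP <-.
apply/crossP => _ _ /imsetP[A AF ->] /imsetP[B BF ->].
case: shiftP => [jA iA _|hA]; case: shiftP => [jB iB _|hB].
- by exists i; rewrite setU11.
- exact: moved_fixed.
- by have [z] := moved_fixed _ _ BF AF jB iB hA; exists z.
- exact: cF.
Qed.

Definition total_weight F := \sum_(A in F) weight A.

Lemma shift_family_weight F i j A : i < j -> A \in F -> movable F i j A ->
  total_weight (shift_family F i j) < total_weight F.
Proof.
move=> ij AF mA; rewrite /total_weight big_imset /=; last exact: shift_inj.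
have lt_swap B : j \in B -> i \notin B -> weight (i |: B :\ j) < weight B.
  by move=> jB iB; rewrite -(ltn_add2r j) weight_swap // ltn_add2l.
rewrite !(big_setD1 A AF) /= -addSn leq_add //.
  by rewrite /shift mA; case/and3P: mA => jA iA _; apply: lt_swap.
by apply: leq_sum => B _; case: shiftP => // jB iB _; rewrite ltnW ?lt_swap.
Qed.
End Shifting.

(** Shifting continues as long as no common point appears, by induction on the total weight. If a
    shift creates one, [two_point_bound] applies to the family before that shift. *)
Theorem hilton_milner k (F : {set {set 'I_k.*2.+1}}) :
  F \subset draws setT k -> cross F F ->
  (forall x, exists2 A, A \in F & x \notin A) ->
  #|F| + k <= ('C(k.*2, k.-1)).+1.
Proof.
have [n] := ubnP (total_weight F); elim: n F => // n IHn F ltw FT cF ntF.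
have [/existsP[i /existsP[j /exists_inP[A AF /andP[ij mA]]]]|sF] :=
  boolP [exists i : 'I_k.*2.+1, exists j : 'I_k.*2.+1, [exists A in F, (i < j) && movable F i j A]].
  rewrite -(card_shift_family F i j).
  have [/forallP nt|] := boolP [forall x, [exists A in shift_family F i j, x \notin A]].
    apply: IHn; [|exact: shift_family_draws|exact: shift_family_cross|].
    - by apply: leq_trans (shift_family_weight ij AF mA) _; rewrite -ltnS.
    - by move=> x; apply/exists_inP.
  rewrite negb_forall => /existsP[z]; rewrite negb_exists_in => /forall_inP allz.
  have zS B : B \in F -> z \in shift F i j B.
    by move=> BF; have := allz _ (imset_f (shift F i j) BF); rewrite negbK.
  rewrite card_shift_family; apply: (@two_point_bound _ setT F k i j) => //.
  - by rewrite cardsT card_ord.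
  - by rewrite -val_eqE ltn_eqF.
  (* A member avoiding [z] must have moved, so [z = i]; any member then contains [i], or has moved
     and contains [j]. *)
  - move=> B BF; have [B0 B0F zB0] := ntF z.
    have := zS _ B0F; case: shiftP => [jB0 iB0 _|_]; last by rewrite (negPf zB0).
    rewrite !inE (negPf zB0) andbF orbF => /eqP zi.
    have := zS _ BF; case: shiftP => [-> |_]; first by rewrite orbT.
    by rewrite zi => ->.
have shF : shifted F.
  move=> A i j AF ij jA iA; apply/negPn/negP => nF; case/negP: sF.
  apply/existsP; exists i; apply/existsP; exists j; apply/exists_inP.
  by exists A; rewrite // ij /movable jA iA.
have [A AF o0] := ntF ord0.
have eT : below k.*2.+1 k.*2.+1 = [set: 'I_k.*2.+1].
  by apply/setP => i; rewrite !inE ltn_ord.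
have posA i : i \in A -> 0 < i.
  move=> iA; rewrite lt0n; apply: contra o0 => /eqP i0.
  by rewrite (_ : ord0 = i) //; apply: val_inj.
have k0 : 0 < k.
  by have /drawsP[_ <-] := subsetP FT _ AF; apply: cross_self_gt0 cF AF.
(* On [k.*2.+1] points the subtracted coefficient is ['C(k, k.-1) = k]. *)
have := @shifted_hilton_milner _ k.*2.+1 k F A (leqnn _) (leqnSn _).
rewrite eT => /(_ FT shF cF AF posA) /=.
have -> : k.*2.+1 - k.+1 = k by lia.
have -> : 'C(k, k.-1) = k by case: (k) k0 => // s _; rewrite /= binSn.
by [].
Qed.

(** * Bounds for intersecting families at half size *)

Lemma common_point_or_small k (F : {set {set 'I_k.*2.+1}}) :
  F \subset draws setT k -> cross F F ->
  (exists x, forall A, A \in F -> x \in A) \/ #|F| + k <= ('C(k.*2, k.-1)).+1.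
Proof.
move=> FT cF.
have [nt|] := boolP [forall x : 'I_k.*2.+1, [exists A in F, x \notin A]].
  right; apply: hilton_milner => // x; apply/exists_inP; exact: (forallP nt).
rewrite negb_forall => /existsP[x]; rewrite negb_exists_in => /forall_inP all_x.
by left; exists x => A /all_x; rewrite negbK.
Qed.

(** For odd [m], either a common point is removed and the remaining sets are counted, or the
    Hilton-Milner bound is at least as strong because [m./2] is positive. For even [m], complements
    decide. *)
Lemma erdos_ko_rado_half m (F : {set {set 'I_m}}) : 0 < m./2 ->
  F \subset draws setT m./2 -> cross F F -> #|F| <= 'C(m.-1, m./2.-1).
Proof.
case: (boolP (odd m)) => [om|em] k0.
  have em : m = (m./2).*2.+1 by rewrite -[LHS]odd_double_half om.
  move: (m./2) em k0 => k em; subst m => k0 FT cF /=.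
  case: (common_point_or_small FT cF) => [[x Fx]|]; last first.
    by move: k0; clear; move: #|_| 'C(_, _) => a b; lia.
  have d0 : #|deletion x F| = 0.
    apply/eqP; rewrite cards_eq0; apply/eqP/setP => A; rewrite !inE.
    by apply/negP => /andP[/Fx ->].
  rewrite (card_split x) d0 add0n.
  have cT : #|[set: 'I_k.*2.+1] :\ x| = k.*2.
    by apply: succn_inj; rewrite -[RHS]card_ord -cardsT (cardsD1 x [set: _]) inE.
  rewrite -[k.*2 in leqRHS]cT -cards_draws subset_leq_card //.
  by apply: link_draws; rewrite prednK.
have e2 : m = (m./2).*2 by rewrite -[LHS]odd_double_half (negPf em).
move=> FT cF; have := intersecting_double _ FT k0 cF.
by rewrite -e2; apply; rewrite cardsT card_ord.
Qed.

(** * Supports of the columns *)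

(** Serves to show that the hypothesis on the number of columns forces at least two of them. *)
Lemma leq_bin n j : 0 < j < n -> n <= 'C(n, j).
Proof.
elim: n j => // n IHn [//|j]; rewrite ltnS /= => jn; rewrite binS.
have [->|jn'] := eqVneq n j.+1; first by rewrite binn binSn.
have jn2 : j.+1 < n by rewrite ltn_neqAle eq_sym jn' -ltnS jn.
have := IHn j.+1 jn2; have : 0 < 'C(n, j) by rewrite bin_gt0 ltnW.
clear; move: 'C(_, _) 'C(_, _) => a b; lia.
Qed.

Lemma covering_pair m n (C : 'M[bool]_(m, n)) : covering_array 2 C ->
  forall j l, j != l -> forall a b, exists i, C i j = a /\ C i l = b.
Proof.
move=> hC j l jl a b.
pose f (i : 'I_2) := if i == ord0 then j else l.
have f_inj : injective f.
  move=> x y; rewrite /f.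
  case: (eqVneq x ord0) => [->|x0]; case: (eqVneq y ord0) => [->|y0] // e.
  - by rewrite e eqxx in jl.
  - by rewrite e eqxx in jl.
  - by apply/val_inj; case: x y x0 y0 {e} => [[|[]]] // ? [[|[]]].
have [i /rowP hi] := hC f f_inj (\row_c (if c == ord0 then a else b))%R.
exists i; have := hi ord0; have := hi (lift ord0 ord0).
by rewrite !mxE /f /=.
Qed.

Section Covering.
Variables (m n : nat) (C : 'M[bool]_(m, n)).
Hypotheses (hm : 4 <= m)
  (hC : forall j l, j != l -> forall a b, exists i, C i j = a /\ C i l = b)
  (hn : 'C(m.-1, m./2.-1) + m < n + 3 * m./2).

Definition xor_col (e : 'I_n -> bool) j : {set 'I_m} := [set i | C i j (+) e j].

Lemma xor_colP e j l : j != l -> forall a b, exists i, (i \in xor_col e j) = a /\ (i \in xor_col e l) = b.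
Proof.
move=> jl a b; have [i [h1 h2]] := hC jl (a (+) e j) (b (+) e l).
by exists i; rewrite !inE h1 h2 -!addbA !addbb !addbF.
Qed.

Lemma xor_col_inj e : injective (xor_col e).
Proof.
move=> j l ejl; apply/eqP; apply: contraT => jl.
by have [i []] := xor_colP e jl true false; rewrite ejl => ->.
Qed.

Lemma eq_xor_col e1 e2 j : e1 j = e2 j -> xor_col e1 j = xor_col e2 j.
Proof. by move=> e12; apply/setP => i; rewrite !inE e12. Qed.

Lemma eq_xor_colC e1 e2 j : e1 j = ~~ e2 j -> xor_col e1 j = ~: xor_col e2 j.
Proof. by move=> e12; apply/setP => i; rewrite !inE e12 addbN. Qed.

Definition heavy j := m./2 < #|[set i | C i j]|.

Lemma card_xor_col_heavy j : #|xor_col heavy j| <= m./2.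
Proof.
case h : (heavy j); rewrite /heavy in h.
  have -> : xor_col heavy j = ~: [set i | C i j].
    by apply/setP=> i; rewrite !inE /heavy h addbT.
  have := cardsC [set i | C i j]; rewrite card_ord; move: h.
  move: #|_| #|_| => a b; lia.
have -> : xor_col heavy j = [set i | C i j].
  by apply/setP=> i; rewrite !inE /heavy h addbF.
by rewrite leqNgt h.
Qed.

Let F := [set xor_col heavy j | j in 'I_n].

Lemma card_xor_cols : #|F| = n.
Proof. by rewrite card_imset ?card_ord //; apply: xor_col_inj. Qed.

Lemma xor_cols_cross : cross F F.
Proof.
have n1 : 1 < n.
  have := @leq_bin m.-1 m./2.-1; move: hn; move: 'C(_, _) => b; move: hm; clear; lia.
have pair j l : j != l -> exists2 x, x \in xor_col heavy j & x \in xor_col heavy l.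
  by move=> jl; have [i []] := xor_colP heavy jl true true; exists i.
apply/crossP => _ _ /imsetP[j _ ->] /imsetP[l _ ->].
have [<-|/pair//] := eqVneq j l.
(* A support is nonempty because its column shows the pattern [(1, 1)] with some other column. *)
have [l' jl'] : exists l', j != l'.
  apply/existsP; apply: contraLR n1 => /existsPn allj.
  rewrite -leqNgt -[n in n <= _]card_ord -(cards1 j) -cardsT subset_leq_card //.
  by apply/subsetP => l' _; rewrite inE eq_sym; apply/negPn/allj.
by have [x xj _] := pair _ _ jl'; exists x.
Qed.

(** A smaller support would, after lifting, give an intersecting family of at least [n + m - m./2]
    sets of size [m./2], more than the Erdos-Ko-Rado bound allows. *)
Lemma card_xor_col_heavy_eq j : #|xor_col heavy j| = m./2.
Proof.
apply/eqP; rewrite eqn_leq card_xor_col_heavy /= leqNgt; apply/negP => lt_j.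
have [] := @lift_uniform _ setT F m./2.
- by rewrite cardsT card_ord; move: hm; clear; lia.
- exact: xor_cols_cross.
- move=> _ _ /imsetP[a _ ->] /imsetP[b _ ->] /subsetP sab.
  have [-> //|ab] := eqVneq a b.
  by have [i [/sab]] := xor_colP heavy ab true false => ->.
- by move=> _ /imsetP[a _ ->]; rewrite subsetT card_xor_col_heavy.
- by exists (xor_col heavy j); rewrite ?imset_f.
move=> G [GT cG]; rewrite card_xor_cols cardsT card_ord => leG.
have k0 : 0 < m./2 by move: hm; clear; lia.
have := erdos_ko_rado_half k0 GT cG.
move: leG hn hm; clear; move: #|_| 'C(_, _) => a b; lia.
Qed.

Lemma normalizing_complements : exists e r, forall j,
  #|xor_col e j| = m./2 /\ r \in xor_col e j.
Proof.
have FT : F \subset draws setT m./2.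
  apply/subsetP => _ /imsetP[j _ ->]; apply/drawsP.
  by rewrite subsetT card_xor_col_heavy_eq.
have [om|em] := boolP (odd m).
  have [x Fx] : exists x, forall A, A \in F -> x \in A.
    have em : m = (m./2).*2.+1 by rewrite -[LHS]odd_double_half om.
    have cF := card_xor_cols; have xF := xor_cols_cross.
    move: F FT cF xF hn; move: (m./2) em => k em.
    clear hn om F hC C; subst m => F FT cF xF hn.
    (* The hypothesis on [n] now amounts to ['C(k.*2, k.-1) + 1 < n + k], exactly the negation of
       the second alternative. *)
    case: (common_point_or_small FT xF) => //; rewrite cF.
    by move: hn => /=; move: 'C(_, _) => b; lia.
  exists heavy, x => j; rewrite card_xor_col_heavy_eq; split=> //.
  by apply: Fx; rewrite imset_f.
have m0 : 0 < m by apply: leq_trans hm.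
(* For even [m] complements of supports keep the size [m./2], so any row can be put into all of
   them; the first is chosen. *)
pose r := Ordinal m0.
exists (fun j => heavy j (+) (r \notin xor_col heavy j)), r => j.
have [rj|rj] := boolP (r \in xor_col heavy j).
  rewrite (@eq_xor_col _ heavy) ?rj ?addbF //.
  by rewrite card_xor_col_heavy_eq.
rewrite (@eq_xor_colC _ heavy) ?rj ?addbT //.
rewrite in_setC rj; split=> //.
have := cardsC (xor_col heavy j); rewrite card_ord card_xor_col_heavy_eq.
have := odd_double_half m; rewrite (negPf em); clear; move: #|_| => a; lia.
Qed.

Lemma wt_col i : (~~ odd m -> wt (col i C) = m./2) /\
  (odd m -> wt (col i C) = m./2 \/ wt (col i C) = m./2.+1).
Proof.
have -> : wt (col i C) = #|[set j | C j i]|.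
  by apply: eq_card => j; rewrite !inE mxE.
have := card_xor_col_heavy_eq i; have := odd_double_half m.
case h : (heavy i).
  have -> : xor_col heavy i = ~: [set j | C j i].
    by apply/setP=> j; rewrite !inE h addbT.
  have := cardsC [set j | C j i]; rewrite card_ord.
  clear; move: #|_| #|_| => a b; case: (odd m) => /=; lia.
have -> : xor_col heavy i = [set j | C j i].
  by apply/setP=> j; rewrite !inE h addbF.
by move=> _ ->; split=> // _; left.
Qed.
End Covering.

(** * Equivalence of matrices *)

Lemma equivalent_complements m n (A : 'M[bool]_(m, n)) (e : 'I_n -> bool) :
  equivalent A (\matrix_(i, j) (A i j (+) e j))%R.
Proof.
have comp s : uniq s -> equivalent A (\matrix_(i, j) (A i j (+) (j \in s)))%R.
  elim: s => [_|j s IHs /= /andP[js us]].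
    rewrite (_ : (\matrix_(_, _) _)%R = A); first exact: equivalent_refl.
    by apply/matrixP => i l; rewrite mxE addbF.
  have := equivalent_compl_col j (IHs us).
  rewrite (_ : compl_col _ _ = (\matrix_(i, l) (A i l (+) (l \in j :: s)))%R) //.
  apply/matrixP => i l; rewrite !mxE inE.
  by have [->|//] := eqVneq l j; rewrite (negPf js) addbF addbT.
have := comp (enum e) (enum_uniq e).
rewrite (_ : (\matrix_(i, j) (A i j (+) (j \in enum e)))%R = (\matrix_(i, j) (A i j (+) e j))%R) //.
by apply/matrixP => i l; rewrite !mxE mem_enum.
Qed.

Lemma enum_val_ltn N (J : {set 'I_N}) (i j : 'I_#|J|) : i < j -> enum_val i < enum_val j.
Proof.
move=> ij; pose x := enum_val i.
have sz : size (map val (enum J)) = #|J| by rewrite size_map -cardE.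
have srt : sorted ltn (map val (enum J)).
  rewrite sorted_map /enum_mem sorted_filter //; first exact: ltn_trans.
  by rewrite -sorted_map -enumT val_enum_ord iota_ltn_sorted.
have ev (l : 'I_#|J|) : val (enum_val l) = nth 0 (map val (enum J)) l.
  by rewrite (nth_map x) -?cardE // -enum_val_nth.
rewrite -[X in X < _]/(val (enum_val i)) -[X in _ < X]/(val (enum_val j)) !ev.
by apply: (sorted_ltn_nth ltn_trans) => //; rewrite inE sz ltn_ord.
Qed.

(** Since [delete_columns] asks for an increasing selection, the columns have to be sorted by their
    position in the standard array. *)
Lemma increasing_perm n N (g : 'I_n -> 'I_N) : injective g ->
  exists s : 'S_n, {homo (fun i => g (s i)) : i j / i < j}.
Proof.
move=> g_inj; pose J := [set g i | i in 'I_n].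
have cJ : #|J| = n by rewrite card_imset ?card_ord.
pose f (i : 'I_n) := enum_val (cast_ord (esym cJ) i).
have fJ i : exists j, g j == f i.
  have fiJ : f i \in J := enum_valP (cast_ord (esym cJ) i).
  by have /imsetP[j _ ->] := fiJ; exists j.
pose h i := xchoose (fJ i).
have gh i : g (h i) = f i by apply/eqP/(xchooseP (fJ i)).
have h_inj : injective h.
  move=> i j /(congr1 g); rewrite !gh => /enum_val_inj/cast_ord_inj //.
exists (perm h_inj) => i j ij; rewrite !permE !gh.
exact: enum_val_ltn.
Qed.

(** A row swap brings [r] to the top, where it becomes the row of ones; below it the columns are
    distinct vectors of weight [k.-1]. *)
Lemma standard_form p n (C : 'M[bool]_(p.+1, n)) (e : 'I_n -> bool) (r : 'I_p.+1) :
  (forall j, #|xor_col C e j| = p.+1./2 /\ r \in xor_col C e j) ->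
  injective (xor_col C e) ->
  exists C', equivalent C C' /\ delete_columns (standard_array p.+1) C'.
Proof.
move=> De D_inj; set k := p.+1./2.
pose C1 : 'M[bool]_(p.+1, n) := (\matrix_(i, j) (C i j (+) e j))%R.
pose C2 := row_perm (tperm ord0 r) C1.
have C2E i j : C2 i j = (tperm ord0 r i \in xor_col C e j) by rewrite !mxE inE.
have C20 j : C2 ord0 j = true by rewrite C2E tpermL; case: (De j).
pose u j : 'cV[bool]_p := (\col_i C2 (lift ord0 i) j)%R.
have wtu j : wt (u j) = k.-1.
  have [cD rD] := De j.
  rewrite /k -cD (cardsD1 r) rD /= /wt -[LHS](card_imset _ (@lift_inj _ ord0)).
  rewrite -[LHS](card_imset _ (@perm_inj _ (tperm ord0 r))); apply: eq_card => x.
  apply/imsetP/idP => [[_ /imsetP[y + ->] ->]|].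
    rewrite inE mxE C2E => yD; rewrite in_setD1 yD andbT.
    by rewrite -[X in _ != X](tpermL ord0 r) (inj_eq perm_inj) eq_sym neq_lift.
  rewrite in_setD1 => /andP[xr xD]; exists (tperm ord0 r x); rewrite ?tpermK //.
  case: (unliftP ord0 (tperm ord0 r x)) => [y ey|ex].
    by rewrite ey imset_f // inE mxE C2E -ey tpermK.
  by rewrite -[x](tpermK ord0 r) ex tpermL eqxx in xr.
have u_inj : injective u.
  move=> j l /colP ejl; apply: D_inj; apply/setP => x.
  rewrite -[x](tpermK ord0 r) -!C2E.
  case: (unliftP ord0 (tperm ord0 r x)) => [y|] ->; last by rewrite !C20.
  by have := ejl y; rewrite !mxE.
have uW j : u j \in weight_vectors p k.-1 by rewrite inE wtu.
(* The rank of [u j] in the enumeration that orders the columns of the standard array. *)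
pose g j := cast_ord (card_weight_vectors p k.-1) (enum_rank_in (uW j) (u j)).
have stdE i j : standard_array p.+1 i (g j) = C2 i j.
  case: (unliftP ord0 i) => [y|] ->.
    have -> : lift ord0 y = rshift 1 y by apply: val_inj.
    rewrite /standard_array [LHS]col_mxEd mxE /g cast_ordK enum_rankK_in // mxE.
    by congr (C2 _ _); apply: val_inj.
  have -> : (ord0 : 'I_p.+1) = lshift p (ord0 : 'I_1) by apply: val_inj.
  rewrite /standard_array [LHS]col_mxEu mxE.
  by rewrite -(C20 j); congr (C2 _ _); apply: val_inj.
have g_inj : injective g.
  move=> j l ejl; apply: u_inj; apply/colP => i.
  by rewrite mxE [RHS]mxE -!stdE ejl.
have [s s_incr] := increasing_perm g_inj.
exists (col_perm s C2); split.
  apply: equivalent_col_perm; apply: equivalent_row_perm; exact: equivalent_complements.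
exists (fun i => g (s i)); split=> //.
by apply/matrixP => i j; rewrite mxE [RHS]mxE stdE.
Qed.

Theorem theorem3p9 (m n : nat) (C : 'M[bool]_(m, n))
  (hm : 4 <= m)
  (hC : covering_array 2 C)
  (hn : ((('C(m.-1, m./2.-1))%:Z + m%:Z - 3 * (m./2)%:Z)%R < n%:Z)%R) :
  (exists C' : 'M[bool]_(m, n),
     equivalent C C' /\ delete_columns (standard_array m) C') /\
  (forall i : 'I_n,
     (~~ odd m -> wt (col i C) = m./2) /\
     (odd m -> wt (col i C) = m./2 \/ wt (col i C) = m./2.+1)).
Proof.
have pC := covering_pair hC.
have bn : 'C(m.-1, m./2.-1) + m < n + 3 * m./2.
  by move: hn; clear; move: 'C(_, _) => b; lia.
split; last exact: wt_col hm pC bn.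
have [e [r De]] := normalizing_complements hm pC bn.
(* A successor exposes the first row of [standard_array]. *)
case: m C hm pC e r De {hC hn bn} => // p C hm pC e r De.
by apply: (standard_form De); apply: xor_col_inj.
Qed.
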